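(* Under the absolute loss $\ell(\hat y,y)=|\hat y-y|$: (i) for all integers $d,K\ge1$ and $T$ with $8Kd\log(2Kd)\le T$, there exist an instance space $\mathcal X$ and a class $\mathcal H\subset\{0,1\}^{\mathcal X}$ with $\mathsf{VC}(\mathcal H)\le d$ such that $\tilde r_T(\mathcal H,\mathsf U_K^1)\ge\sqrt{KdT/64}$; (ii) there is an absolute constant $c>0$ such that for the class of threshold functions $\mathcal H=\{x\mapsto 1\{x\ge a\}:a\in[0,1]\}$ on $\mathcal X=[0,1]$ and all $1\le K\le T$, $\tilde r_T(\mathcal H,\mathsf U_K^1)\ge c\sqrt{KT}$.
   Context: Predictions lie in $[0,1]$, labels in $\{0,1\}$. For a loss $\ell$, a class $\mathcal H$ of functions $\mathcal X\to[0,1]$ and a class $\mathsf P$ of distributions on $\mathcal X^T$, $$\tilde r_T(\mathcal H,\mathsf P)=\inf_{\phi^T}\sup_{\boldsymbol\nu^T\in\mathsf P}\mathbb E_{\mathbf x^T\sim\boldsymbol\nu^T}\Big[\sup_{y^T\in\{0,1\}^T}\Big(\sum_{t=1}^T\ell(\phi_t(\mathbf x^t,y^{t-1}),y_t)-\inf_{h\in\mathcal H}\sum_{t=1}^T\ell(h(\mathbf x_t),y_t)\Big)\Big],$$ with $\phi_t:\mathcal X^t\times\{0,1\}^{t-1}\to[0,1]$ deterministic prediction rules. For a process $X^T$ let $\nu_t(\cdot\mid X^{t-1})$ be the conditional law of $X_t$ given $X_1,\dots,X_{t-1}$. $\mathsf U_K^1$ is the class of all processes on $\mathcal X^T$ for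 which almost surely the set $\{\nu_t(\cdot\mid X^{t-1}):t\in[T]\}$ has at most $K$ distinct elements. *)

(* Defs.v *)
From HB Require Import structures.
From mathcomp Require Import all_boot all_order all_algebra.
From mathcomp Require Import all_classical all_reals all_analysis.
From mathcomp Require Import measurable_realfun.
From Stdlib Require List.
Set Implicit Arguments.
Unset Strict Implicit.
Unset Printing Implicit Defensive.
Import Order.TTheory GRing.Theory Num.Theory.
Local Open Scope classical_set_scope.
Local Open Scope ring_scope.

(* Stochastic processes on X^T, represented through their conditional laws:  *)
(* pk n h is the law nu_{n+1}( . | X^n = h) of the next coordinate given the  *)
(* history h of length n.  The kernels are required to be measurable in the  *)
(* history (product sigma-algebra on n.-tuple X).                            *)
Record process (d : measure_display) (X : measurableType d) (R : realType) := Process {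
  pk : forall n : nat, n.-tuple X -> probability X R ;
  pk_meas : forall (n : nat) (A : set X), measurable A ->
    measurable_fun [set: n.-tuple X] (fun h : n.-tuple X => pk h A)
}.

Definition kseq d (X : measurableType d) (R : realType) (k : process X R)
  (h : seq X) : probability X R := @pk _ _ _ k _ (in_tuple h).

Fixpoint iexp d (X : measurableType d) (R : realType) (k : process X R)
  (n : nat) (f : seq X -> \bar R) (h : seq X) : \bar R :=
  match n with
  | 0 => f h
  | n'.+1 => (\int[kseq k h]_x iexp k n' f (rcons h x))%E
  end.

Definition pexp d (X : measurableType d) (R : realType) (k : process X R)
  (T : nat) (f : seq X -> \bar R) : \bar R := iexp k T f [::].

Definition pas d (X : measurableType d) (R : realType) (k : process X R)
  (T : nat) (P : seq X -> Prop) : Prop :=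
  pexp k T (fun xs => (\1_[set ys | ~ P ys] xs)%:E) = 0%E.

Definition at_most_K_laws d (X : measurableType d) (R : realType)
  (k : process X R) (K T : nat) (xs : seq X) : Prop :=
  exists g : nat -> (set X -> \bar R),
    forall t : nat, (t < T)%N ->
      exists2 i : nat, (i < K)%N & (kseq k (take t xs) : set X -> \bar R) = g i.

Definition U_K1 d (X : measurableType d) (R : realType) (K T : nat)
  : set (process X R) :=
  [set k | pas k T (at_most_K_laws k K T)].
Arguments U_K1 {d} X R K T.

(* A prediction rule is a family phi_t : X^t x {0,1}^{t-1} -> [0,1], encoded *)
(* as one function on lists (phi xs ys with size xs = t, size ys = t - 1).   *)
Definition abs_loss (R : realType) (yhat : R) (y : bool) : R := `|yhat - y%:R|.

Definition pred_rule (X : Type) (R : realType) : set (seq X -> seq bool -> R) :=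
  [set phi | forall xs ys, 0 <= phi xs ys <= 1].

Definition learner_loss (X : Type) (R : realType) (phi : seq X -> seq bool -> R)
  (T : nat) (xs : seq X) (ys : seq bool) : R :=
  \sum_(t < T) abs_loss (phi (take t.+1 xs) (take t ys)) (nth false ys t).

Definition hyp_loss (X : Type) (R : realType) (h : X -> R)
  (xs : seq X) (ys : seq bool) : R :=
  \sum_(p <- zip xs ys) abs_loss (h p.1) p.2.

(* sup_{y^T} ( learner loss - inf_{h in H} loss of h )  (inf over empty H = +oo) *)
Definition seq_regret (X : Type) (R : realType) (H : set (X -> R))
  (phi : seq X -> seq bool -> R) (T : nat) (xs : seq X) : \bar R :=
  ereal_sup [set ((learner_loss phi T xs ys)%:E
                  - ereal_inf [set (hyp_loss h xs ys)%:E | h in H])%E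
            | ys in [set ys : seq bool | size ys = T]].

Definition minimax_regret d (X : measurableType d) (R : realType)
  (H : set (X -> R)) (P : set (process X R)) (T : nat) : \bar R :=
  ereal_inf [set ereal_sup [set pexp k T (seq_regret H phi T) | k in P]
            | phi in @pred_rule X R].

Definition binary_class (X : Type) (R : realType) (H : set (X -> R)) : Prop :=
  forall h, H h -> forall x, h x = 0 \/ h x = 1.

Definition shatters (X : Type) (R : realType) (H : set (X -> R)) (S : list X) :=
  forall b : X -> bool, exists2 h, H h & forall x, List.In x S -> h x = (b x)%:R.

Definition VC_le (X : Type) (R : realType) (H : set (X -> R)) (n : nat) : Prop :=
  forall S : list X, List.NoDup S -> shatters H S -> (length S <= n)%N.

Definition thresholds (R : realType) : set (R -> R) :=
  [set h | exists2 a : R, 0 <= a <= 1 & h = (fun x : R => ((a <= x)%R)%:R)].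

(* processes on [0,1]^T, viewed as processes on R^T whose conditional laws   *)
(* are all concentrated on [0,1]                                             *)
Definition on_unit (R : realType) : set (process R R) :=
  [set k | forall h : seq R, (kseq k h `[0%R, 1%R]%classic = 1)%E].
Arguments on_unit R : clear implicits.

(* Main.v *)
Require Import Defs.
From HB Require Import structures.
From mathcomp Require Import all_boot all_order all_algebra.
From mathcomp Require Import all_classical all_reals all_analysis.
From mathcomp Require Import measurable_realfun.
From mathcomp Require Import ring lra zify.
From Stdlib Require List.
Set Implicit Arguments.
Unset Strict Implicit.
Unset Printing Implicit Defensive.
Import Order.TTheory GRing.Theory Num.Theory.
Local Open Scope classical_set_scope.
Local Open Scope ring_scope.

(* Walk down a complete tree whose node at depth k carries d points and whose
   branches are all realized by the class.  A stage consists of L rounds in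
   which the instance is uniform among the d points of the current node,
   followed by one round whose instance is a point that every hypothesis
   labels 0 but that encodes d fresh uniform bits, the direction in which the
   walk continues.  With N stages this uses N + 1 laws, or a single law if
   N = 1 and the stage fills the whole game.

   As the regret is a supremum over the labels, the labels may be coupled with
   the bits so that, for each of the d points, the direction agrees with the
   majority of the labels seen at that point during the stage, while every
   label remains a fair coin given the past.  The learner then loses T / 2 on
   average, while the hypothesis of the branch followed gains half of
   E |S| for each stage and point, S being the sum of the signs of the labels
   seen there.  Its second and fourth moments give E |S| >= sqrt (L / d) / 2,
   hence a regret of at least N sqrt (L d) / 4. *)

(** * Averages over finite types and over tuples *)

Section Average.
Context {R : realFieldType}.

Definition avg (I : finType) (F : I -> R) : R := (\sum_i F i) / #|I|%:R.

Lemma eq_avg (I : finType) (F G : I -> R) : F =1 G -> avg F = avg G.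
Proof. by move=> FG; rewrite /avg (eq_bigr _ (fun i _ => FG i)). Qed.

Lemma ler_avg (I : finType) (F G : I -> R) :
  (forall i, F i <= G i) -> avg F <= avg G.
Proof.
by move=> FG; rewrite ler_wpM2r ?invr_ge0 ?ler0n//; apply: ler_sum.
Qed.

Lemma avg_cst (I : finType) (i0 : I) (c : R) : avg (fun _ : I => c) = c.
Proof.
have I0 : (0 < #|I|)%N by apply/card_gt0P; exists i0.
by rewrite /avg sumr_const -[c *+ _]mulr_natr mulfK// pnatr_eq0 -lt0n.
Qed.

Lemma avgD (I : finType) (F G : I -> R) :
  avg (fun i => F i + G i) = avg F + avg G.
Proof. by rewrite /avg big_split/= mulrDl. Qed.

Lemma avgZ (I : finType) (c : R) (F : I -> R) :
  avg (fun i => c * F i) = c * avg F.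
Proof. by rewrite /avg -mulr_sumr mulrA. Qed.

Lemma avgB (I : finType) (F G : I -> R) :
  avg (fun i => F i - G i) = avg F - avg G.
Proof. by rewrite /avg sumrB mulrBl. Qed.

Lemma avg_sum (I J : finType) (P : pred J) (F : J -> I -> R) :
  avg (fun i => \sum_(j | P j) F j i) = \sum_(j | P j) avg (F j).
Proof. by rewrite /avg exchange_big/= mulr_suml. Qed.

Lemma exchange_avg (I J : finType) (F : I -> J -> R) :
  avg (fun i => avg (F i)) = avg (fun j => avg (F ^~ j)).
Proof. by rewrite /avg -!mulr_suml exchange_big/= mulrAC. Qed.

Lemma reindex_avg (I : finType) (h : I -> I) (F : I -> R) :
  involutive h -> avg F = avg (fun i => F (h i)).
Proof. by move=> hK; rewrite /avg (reindex_inj (inv_inj hK)). Qed.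

Lemma avg_pair (I J : finType) (F : I * J -> R) :
  avg F = avg (fun i => avg (fun j => F (i, j))).
Proof.
by rewrite /avg -mulr_suml pair_bigA card_prod natrM invfM mulrA mulrAC;
  congr (_ * _ * _); apply: eq_bigr => -[].
Qed.

Lemma avg_tuple0 (I : finType) (F : seq I -> R) :
  avg (fun t : 0.-tuple I => F t) = F [::].
Proof.
by rewrite -[RHS](avg_cst (nil_tuple I)); apply: eq_avg => t; rewrite tuple0.
Qed.

Lemma avg_tupleS (I : finType) n (F : seq I -> R) :
  avg (fun t : n.+1.-tuple I => F t) =
  avg (fun i => avg (fun t : n.-tuple I => F (i :: t))).
Proof.
rewrite -(avg_pair (fun x : I * n.-tuple I => F (x.1 :: x.2))) /avg.
rewrite card_prod !card_tuple expnS; congr (_ / _).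
rewrite (reindex (fun x : I * n.-tuple I => cons_tuple x.1 x.2))//=.
exists (fun t => (thead t, behead_tuple t)) => [[i t] _|t _] /=.
  by rewrite theadE; congr pair; apply/val_inj.
by apply/val_inj; rewrite [in RHS](tuple_eta t).
Qed.

(** Turns two independent tuples into one tuple of independent pairs, the form that the moment
    bounds require. *)
Lemma avg_zip (I J : finType) n (F : seq I -> seq J -> R) :
  avg (fun s : n.-tuple I => avg (fun t : n.-tuple J => F s t)) =
  avg (fun t : n.-tuple (I * J) => F (unzip1 t) (unzip2 t)).
Proof.
elim: n F => [|n IH] F.
  rewrite (avg_tuple0 (fun t => F (unzip1 t) (unzip2 t))).
  rewrite (avg_tuple0 (fun s => avg (fun t : 0.-tuple J => F s t))).
  exact: avg_tuple0.
rewrite (avg_tupleS n (fun s => avg (fun t : n.+1.-tuple J => F s t))).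
rewrite (avg_tupleS n (fun t => F (unzip1 t) (unzip2 t))) avg_pair.
apply: eq_avg => i.
under eq_avg => s do rewrite (avg_tupleS n (F (i :: s))).
rewrite exchange_avg; apply: eq_avg => j.
  exact: (IH (fun s t => F (i :: s) (j :: t))).
Qed.

End Average.

(** * Image of the uniform law on a finite type *)

Section UniformLaw.
Import HBNNSimple.
Context d (X : measurableType d) (R : realType) (I : finType) (i0 : I).
Variable p : I -> X.

Let q (k : nat) : X := p (nth i0 (enum I) k).

(** Dirac masses at the points [p i], counted with multiplicity. The cardinal [#|I|], nonzero thanks
    to [i0], is written as a successor. *)
Definition unif_law : set X -> \bar R :=
  mscale (#|I|.-1.+1%:R^-1%:nng : {nonneg R})
         (msum (fun k => \d_(q k)) #|I|.-1.+1).

HB.instance Definition _ := Measure.on unif_law.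

Let cardI : #|I|.-1.+1 = #|I|.
Proof. by rewrite prednK//; apply/card_gt0P; exists i0. Qed.

Let sum_enum (F : I -> R) :
  \sum_(k < #|I|.-1.+1) F (nth i0 (enum I) k) = \sum_i F i.
Proof.
rewrite cardI -(big_mkord xpredT (fun k => F (nth i0 (enum I) k))).
by rewrite cardE -(big_nth i0 xpredT) big_enum.
Qed.

Let sumE (F : I -> R) :
  (#|I|.-1.+1%:R^-1%:E * \sum_(k < #|I|.-1.+1) (F (nth i0 (enum I) k))%:E)%E
  = (avg F)%:E.
Proof. by rewrite sumEFin -EFinM sum_enum cardI mulrC. Qed.

Lemma unif_lawE (A : set X) : unif_law A = (avg (fun i => \1_A (p i)))%:E.
Proof. by rewrite -sumE. Qed.

Lemma unif_law_eq1 (A : set X) : (forall i, A (p i)) -> unif_law A = 1%E.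
Proof.
move=> Ap; rewrite unif_lawE -(@avg_cst R I i0 1).
by congr EFin; apply: eq_avg => i; rewrite indicE mem_set.
Qed.

Let unif_lawT : unif_law setT = 1%E.
Proof. exact: unif_law_eq1. Qed.

HB.instance Definition _ := Measure_isProbability.Build _ _ _ unif_law unif_lawT.

Lemma ge0_integral_unif (f : X -> R) : (forall x, 0 <= f x) ->
  measurable_fun setT f ->
  (\int[unif_law]_x (f x)%:E = (avg (f \o p))%:E)%E.
Proof.
move=> f0 mf; have mf' : measurable_fun setT (EFin \o f) by exact/measurable_EFinP.
rewrite /unif_law ge0_integral_mscale//=; last by move=> x _; rewrite lee_fin.
rewrite ge0_integral_measure_sum//=; last by move=> x _; rewrite lee_fin.
rewrite -sumE; congr (_ * _)%E; apply: eq_bigr => k _.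
by rewrite integral_dirac//= diracT mul1e.
Qed.

Hypothesis meas1 : forall x : X, measurable [set x].

Lemma finite_measurable (A : set X) : finite_set A -> measurable A.
Proof.
move=> fA; rewrite -[A]image_id.
rewrite -bigcup_imset1; apply: fin_bigcup_measurable => // x _; exact: meas1.
Qed.

(** A preimage is a finite part of [S], together with all or none of the complement of [S] according
    to whether it is the preimage of a set containing 0. *)
Lemma finite_support_measurable (f : X -> R) (S : set X) : finite_set S ->
  (forall x, ~ S x -> f x = 0) -> measurable_fun setT f.
Proof.
move=> fS f0 _ B mB; rewrite setTI.
have -> : f @^-1` B = (S `&` f @^-1` B) `|` (~` S `&` f @^-1` B).
  by rewrite -setIUl setUv setTI.
apply: measurableU.
  by apply: finite_measurable; exact: finite_setIl.
have [B0|B0] := pselect (B 0).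
  rewrite (_ : _ `&` _ = ~` S); first exact/measurableC/finite_measurable.
  by apply/seteqP; split=> x /=; [case|move=> Sx; rewrite f0].
rewrite (_ : _ `&` _ = set0)//.
by apply/seteqP; split=> x //= [Sx]; rewrite f0.
Qed.

(* The integrand need not be measurable: its integral is the lower integral
   of its positive part minus the lower integral of its negative part. *)
Lemma unif_integral_ge (f : X -> \bar R) (g : I -> R) :
  (forall i, ((g i)%:E <= f (p i))%E) ->
  ((avg g)%:E <= \int[unif_law]_x f x)%E.
Proof.
move=> gf; rewrite integralE.
pose C := \sum_i `|g i|.
have gC i : g i <= C.
  rewrite (le_trans (ler_norm _))// /C (bigD1 i)//= lerDl; exact: sumr_ge0.
have C0 : 0 <= C by exact: sumr_ge0.
pose S := range p.
(* A measurable minorant of [f^\+]: cutting at [C] makes it finite, yet it still dominates [g] at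
   the points [p i]. *)
pose u x := if x \in S then fine (mine (f^\+ x) C%:E)%E else 0.
have ux x : (x \in S -> (u x)%:E = mine (f^\+ x) C%:E)%E.
  move=> xS; rewrite /u xS fineK//.
  have [//|h] := leP (C%:E) (f^\+ x)%E; rewrite ?minElt.
  by rewrite ge0_fin_numE ?funepos_ge0// (lt_trans h)// ltry.
have u0 x : 0 <= u x.
  rewrite -lee_fin; case xS: (x \in S); last by rewrite /u xS.
  by rewrite ux// le_min funepos_ge0 lee_fin.
have fS : finite_set S by apply: finite_image; exact: finite_finset.
have mu : measurable_fun setT u.
  by apply: (@finite_support_measurable _ S) => // x xS; rewrite /u memNset.
have lo : ((avg (fun i => Num.max (g i) 0))%:E <= \int[unif_law]_x f^\+ x)%E.
  apply: (@le_trans _ _ (\int[unif_law]_x (u x)%:E)%E).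
    rewrite ge0_integral_unif// lee_fin; apply: ler_avg => i /=.
    rewrite -lee_fin ux; last by rewrite inE; exists i.
    rewrite le_min lee_fin ge_max gC C0 andbT funeposE.
    by rewrite EFin_max ge_max !le_max gf lexx orbT.
  rewrite !ge0_integralTE//.
  apply: le_ereal_sup => _ [h /= hu <-]; exists h => // x.
  apply: le_trans (hu x) _; case xS: (x \in S); first by rewrite ux// ge_min lexx.
  by rewrite /u xS funepos_ge0.
have up : (\int[unif_law]_x f^\- x <= (avg (fun i => Num.max (- g i) 0))%:E)%E.
  rewrite ge0_integralTE//; apply: ge_ereal_sup => _ [h /= hf <-].
  rewrite -integralT_nnsfun ge0_integral_unif//.
  rewrite lee_fin; apply: ler_avg => i /=; rewrite -lee_fin.
  apply: le_trans (hf _) _; rewrite funenegE EFin_max EFinN ge_max !le_max.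
  by rewrite leeN2 gf lexx orbT.
apply: le_trans (leeB lo up).
  rewrite -EFinB lee_fin -avgB; apply: ler_avg => i.
  by rewrite /Num.max; case: ifP; case: ifP; lra.
Qed.

End UniformLaw.

Lemma finite_range_measurable_fun d1 d2 (T : measurableType d1)
    (Y : measurableType d2) (J : finType) (u : T -> J) (phi : J -> Y) :
  (forall j, measurable (u @^-1` [set j])) -> measurable_fun setT (phi \o u).
Proof.
move=> mu _ B mB; rewrite setTI.
rewrite (_ : _ @^-1` _ = \bigcup_(j in phi @^-1` B) (u @^-1` [set j])).
  exact: fin_bigcup_measurable.
by apply/seteqP; split=> [x /= Bx|x [j /= Bj ->]]//; exists (u x).
Qed.

(** * Timetable of the stages *)

Section Schedule.
Local Open Scope nat_scope.
Variables N L : nat.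

Definition stage (t : nat) : nat := t %/ L.+1.
(** The rounds left over after [N] stages count as noise rounds. *)
Definition playing (t : nat) : bool := (t %% L.+1 < L) && (stage t < N).
Definition noise_time (k : nat) : nat := k * L.+1 + L.

Lemma stage_noise_time k : stage (noise_time k) = k.
Proof. by rewrite /stage /noise_time divnMDl// divn_small// addn0. Qed.

Lemma noise_time_not_playing k : playing (noise_time k) = false.
Proof. by rewrite /playing /noise_time modnMDl modn_small// ltnn. Qed.

Lemma noise_time_lt k m : k < stage m -> noise_time k < m.
Proof.
move=> km; rewrite /noise_time; have := leq_divM m L.+1.
move: (leq_mul km (leqnn L.+1)); rewrite -/(stage m); lia.
Qed.

Lemma playing_lt_noise_time t : playing t -> t < noise_time (stage t).
Proof.
by move=> /andP[tL _]; rewrite {1}(divn_eq t L.+1) /noise_time ltn_add2l.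
Qed.

End Schedule.

(** * The process that walks down the tree *)

Section Process.
Context dX (X : measurableType dX) (R : realType) (d : nat).
Notation V := {ffun 'I_d.+1 -> bool}.
Notation Om := ('I_d.+1 * V)%type.
Variables (pt : seq V -> 'I_d.+1 -> X) (z : V -> X) (decode : X -> V).
Variables N L : nat.

Let v0 : V := [ffun=> false].
Let om0 : Om := (ord0, v0).
Notation noise_time_ := (noise_time L).
Notation stage_ := (stage L).
Notation playing_ := (playing N L).

Definition round_point (n : nat) (v : nat -> V) (o : Om) : X :=
  if playing_ n then pt (mkseq (fun k => v (noise_time_ k)) (stage_ n)) o.1
  else z o.2.

(** The directions consulted at time [n] were drawn at the ends of stages already over, hence before
    [n]. *)
Lemma eq_round_point n (v v' : nat -> V) :
  (forall k, (k < n)%N -> v k = v' k) -> round_point n v = round_point n v'.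
Proof.
move=> vv'; apply/funext => o; rewrite /round_point; case: ifP => // _; congr pt.
apply/eq_in_map => k; rewrite mem_iota => /andP[_ kn].
exact/vv'/noise_time_lt.
Qed.

(* The law after [h] is the image of the uniform law on [Om]: the first
   component of the outcome is used in playing rounds, the second in noise
   rounds.  [decode] reads the past directions back from the instances. *)
Definition round_law (n : nat) (h : seq X) : probability X R :=
  unif_law R om0 (round_point n (nth v0 (map decode h))).

Hypothesis decode_meas : forall v, measurable (decode @^-1` [set v]).

Lemma round_law_meas n (A : set X) : measurable A ->
  measurable_fun [set: n.-tuple X] (fun h : n.-tuple X => round_law n h A).
Proof.
move=> mA.
(* The history enters only through its decoded tuple, which takes finitely many values. *)
pose phi (w : n.-tuple V) : \bar R :=
  (avg (fun o => \1_A (round_point n (nth v0 w) o)))%:E.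
rewrite (_ : (fun h : n.-tuple X => _) = phi \o map_tuple decode); last first.
  by apply/funext => h; rewrite /round_law/= unif_lawE.
apply: finite_range_measurable_fun => w.
rewrite (_ : _ @^-1` _ =
  \big[setI/setT]_(i < n) ((@tnth n X)^~ i @^-1` (decode @^-1` [set tnth w i]))).
  apply: bigsetI_measurable => i _.
  rewrite -[X in measurable X]setTI; apply: measurable_tnth => //.
apply/seteqP; split=> h /=.
  by move=> <-; elim/big_ind: _ => // i _; rewrite /= tnth_map.
rewrite -bigcap_seq => hw; apply: eq_from_tnth => i.
by rewrite tnth_map; apply: (hw i) => /=; rewrite mem_index_enum.
Qed.

Definition tree_process : process X R :=
  @Process _ X R (fun n h => round_law n h) round_law_meas.

Lemma kseq_tree_process h : kseq tree_process h = round_law (size h) h.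
Proof. by []. Qed.

(** Directions come from the outcomes [o] themselves, not from decoding the instances. *)
Definition trajectory (o : nat -> Om) (n : nat) : seq X :=
  mkseq (fun t => round_point t (fun i => (o i).2) (o t)) n.

Hypothesis zK : cancel z decode.
Hypothesis meas1 : forall x : X, measurable [set x].

(** Decoded values are consulted only at noise times, where the instance is [z] of the direction and
    [zK] recovers it. *)
Lemma round_law_trajectory (s : seq Om) :
  round_law (size s) (trajectory (nth om0 s) (size s)) =
  unif_law R om0 (round_point (size s) (fun i => (nth om0 s i).2)).
Proof.
rewrite /round_law; suff -> : round_point (size s)
    (nth v0 [seq decode i | i <- trajectory (nth om0 s) (size s)]) =
    round_point (size s) (fun i => (nth om0 s i).2) by [].
apply/funext => o; rewrite /round_point; case: ifP => // _; congr pt.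
apply/eq_in_map => k; rewrite mem_iota => /andP[_ /noise_time_lt kn].
rewrite (nth_map (z v0)) ?size_mkseq// nth_mkseq// /round_point.
by rewrite noise_time_not_playing zK.
Qed.

Lemma eq_trajectory (o o' : nat -> Om) n :
  (forall t, (t < n)%N -> o t = o' t) -> trajectory o n = trajectory o' n.
Proof.
move=> oo'; apply/eq_in_map => t; rewrite mem_iota => /andP[_ tn].
rewrite (oo' _ tn) (@eq_round_point _ _ (fun i => (o' i).2))// => k kt.
by rewrite oo'// (ltn_trans kt).
Qed.

Lemma trajectoryS (s : seq Om) o :
  rcons (trajectory (nth om0 s) (size s))
    (round_point (size s) (fun i => (nth om0 s i).2) o) =
  trajectory (nth om0 (rcons s o)) (size s).+1.
Proof.
rewrite /trajectory -[RHS]/(trajectory _ _) /trajectory mkseqS; congr rcons.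
  by apply: eq_trajectory => t ts; rewrite nth_rcons ts.
rewrite nth_rcons ltnn eqxx; congr (_ o); apply: eq_round_point => k ks.
by rewrite nth_rcons ks.
Qed.

(** Induction on the number of rounds left; each integral is bounded below by [unif_integral_ge],
    since the regret of an arbitrary rule may fail to be measurable. *)
Lemma iexp_ge n (f : seq X -> \bar R) (F : seq Om -> R) (s : seq Om) :
  (forall t : n.-tuple Om, ((F (s ++ t))%:E <=
     f (trajectory (nth om0 (s ++ t)) (size s + n)))%E) ->
  ((avg (fun t : n.-tuple Om => F (s ++ t)))%:E <=
   iexp tree_process n f (trajectory (nth om0 s) (size s)))%E.
Proof.
elim: n s => [|n IH] s Ff /=.
  rewrite (avg_tuple0 (fun t => F (s ++ t))).
  by have := Ff [tuple]; rewrite /= cats0 addn0.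
rewrite -[unif_law _ _ _]/(round_law (size (trajectory _ _)) _ : set X -> \bar R).
rewrite size_mkseq round_law_trajectory.
rewrite (avg_tupleS n (fun t => F (s ++ t))).
apply: unif_integral_ge => // o; rewrite trajectoryS.
rewrite -(size_rcons s o).
under eq_avg => t do rewrite -cat_rcons.
apply: IH => t; rewrite size_rcons addSnnS cat_rcons.
exact: (Ff (cons_tuple o t)).
Qed.

Lemma pexp_ge n (f : seq X -> \bar R) (F : seq Om -> R) :
  (forall t : n.-tuple Om, ((F t)%:E <= f (trajectory (nth om0 t) n))%E) ->
  ((avg (fun t : n.-tuple Om => F t))%:E <= pexp tree_process n f)%E.
Proof. exact: (@iexp_ge n f F [::]). Qed.

(** The node is fixed during a stage, so its playing rounds share one law. All noise rounds share
    law number [N], needed only if one of them occurs before [T]. *)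
Lemma tree_process_laws (K T : nat) (xs : seq X) :
  (N <= K)%N -> (forall t, (t < T)%N -> ~~ playing_ t -> (N < K)%N) ->
  at_most_K_laws tree_process K T xs.
Proof.
move=> NK noise.
pose w := nth v0 (map decode xs).
pose g i : set X -> \bar R :=
  if (i < N)%N then
    unif_law R om0 (fun o : Om => pt (mkseq (fun k => w (noise_time_ k)) i) o.1)
  else unif_law R om0 (fun o : Om => z o.2).
exists g => t tT; rewrite kseq_tree_process /round_law.
set m := size _.
have mt : (m <= t)%N by rewrite /m size_take_min geq_minl.
have pw : round_point m (nth v0 [seq decode x | x <- take t xs]) = round_point m w.
  apply: eq_round_point => k km; rewrite map_take nth_take//; exact: leq_trans mt.
rewrite pw; have [pm|pm] := boolP (playing_ m).
  have sN : (stage_ m < N)%N by case/andP: pm.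
  exists (stage_ m); first exact: leq_trans NK.
  by rewrite /g sN /round_point pm.
exists N; first by apply: noise pm; exact: leq_ltn_trans tT.
by rewrite /g ltnn /round_point (negbTE pm).
Qed.

(** The bound on the laws holds for every history, so the indicator of its failure vanishes
    identically. *)
Lemma tree_process_U_K1 (K T : nat) :
  (N <= K)%N -> (forall t, (t < T)%N -> ~~ playing_ t -> (N < K)%N) ->
  U_K1 X R K T tree_process.
Proof.
move=> NK noise; rewrite /U_K1/= /pas /pexp.
set f := fun _ : seq X => _.
have f0 xs : f xs = 0%E.
  by rewrite /f indicE memNset//= => /(_ (tree_process_laws _ NK noise)).
elim: T [::] {noise} f f0 => [|n IH] h f f0 /=; first exact: f0.
by apply: integral0_eq => x _; exact: IH.
Qed.

End Process.

(** * Moments of sums of independent centred variables *)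

Lemma avg_tuple_rcons (R : realFieldType) (I : finType) n (F : seq I -> R) :
  avg (fun t : n.+1.-tuple I => F t) =
  avg (fun t : n.-tuple I => avg (fun i => F (rcons t i))).
Proof.
elim: n F => [|n IH] F.
  rewrite (avg_tuple0 (fun t => avg (fun i => F (rcons t i)))) avg_tupleS.
  by apply: eq_avg => i; rewrite (avg_tuple0 (fun t => F (i :: t))).
rewrite (avg_tupleS n (fun t => avg (fun i => F (rcons t i)))) avg_tupleS.
by apply: eq_avg => i; exact: (IH (fun t => F (i :: t))).
Qed.

Lemma avg_le_ereal (R : realType) (I : finType) (i0 : I) (F : I -> R)
    (x : \bar R) : (forall i, ((F i)%:E <= x)%E) -> ((avg F)%:E <= x)%E.
Proof.
case: x => [r| |] Fx; [|by rewrite leey|by have := Fx i0].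
by rewrite lee_fin -(avg_cst i0 r); apply: ler_avg => i; rewrite -lee_fin.
Qed.

Section Moments.
Context {R : realFieldType} (Z : finType) (z0 : Z).

Let S (a : nat -> Z -> R) n (t : seq Z) := \sum_(r < n) a r (nth z0 t r).

Let S_cons a n x t : S a n.+1 (x :: t) = a 0 x + S (fun r => a r.+1) n t.
Proof. by rewrite /S big_ord_recl. Qed.

Lemma sum_moment2 (a : nat -> Z -> R) n : (forall r, avg (a r) = 0) ->
  avg (fun t : n.-tuple Z => (\sum_(r < n) a r (nth z0 t r)) ^+ 2) =
  \sum_(r < n) avg (fun z => a r z ^+ 2).
Proof.
rewrite -/(S a n); elim: n a => [|n IH] a a0.
  by rewrite big_ord0 (avg_tuple0 (fun t => S a 0 t ^+ 2)) /S big_ord0 expr0n.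
rewrite (avg_tupleS n (fun t => S a n.+1 t ^+ 2)) big_ord_recl/=.
rewrite -(IH (fun r => a r.+1))//=.
have nt : n.-tuple Z := nseq_tuple n z0.
transitivity (avg (fun i => a 0 i ^+ 2
   + (2 * avg (fun t : n.-tuple Z => S (fun r => a r.+1) n t) * a 0 i
   + avg (fun t : n.-tuple Z => S (fun r => a r.+1) n t ^+ 2)))).
  apply: eq_avg => i; rewrite -[in RHS](avg_cst nt (a 0 i ^+ 2)).
  rewrite [2 * _ * _]mulrAC -avgZ -!avgD; apply: eq_avg => t.
  by rewrite S_cons; ring.
by rewrite avgD avgD avgZ a0 mulr0 add0r avg_cst.
Qed.

(** Expanding around the first summand, its odd powers average to 0. What remains is
    [A4 + 6 * m2 * A2 + m4], and the middle term is the cross term of [3 * (A2 + m2)^2]. *)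
Lemma sum_moment4 (a : nat -> Z -> R) n : (forall r, avg (a r) = 0) ->
  (forall r, avg (fun z => a r z ^+ 3) = 0) ->
  avg (fun t : n.-tuple Z => (\sum_(r < n) a r (nth z0 t r)) ^+ 4) <=
  3 * (\sum_(r < n) avg (fun z => a r z ^+ 2)) ^+ 2
  + \sum_(r < n) avg (fun z => a r z ^+ 4).
Proof.
rewrite -/(S a n); elim: n a => [|n IH] a a1 a3.
  rewrite !big_ord0 (avg_tuple0 (fun t => S a 0 t ^+ 4)) /S big_ord0 !expr0n/=.
  by rewrite mulr0 addr0.
rewrite (avg_tupleS n (fun t => S a n.+1 t ^+ 4)) !big_ord_recl/=.
have /= := IH (fun r => a r.+1) (fun r => a1 r.+1) (fun r => a3 r.+1).
have /= := @sum_moment2 (fun r => a r.+1) n (fun r => a1 r.+1).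
set m2 := avg (fun t : n.-tuple Z => (\sum_(r < n) _) ^+ 2) => <-.
set m4 := avg (fun t : n.-tuple Z => (\sum_(r < n) _) ^+ 4).
set A2 := avg (fun z => a 0 z ^+ 2); set A4 := avg (fun z => a 0 z ^+ 4).
set U := \sum_(r < n) _ => IHn.
have nt : n.-tuple Z := nseq_tuple n z0.
have -> : avg (fun i => avg (fun t : n.-tuple Z => S a n.+1 (i :: t) ^+ 4)) =
    A4 + (6 * m2 * A2 + m4).
  transitivity (avg (fun i => a 0 i ^+ 4
     + (4 * avg (fun t : n.-tuple Z => S (fun r => a r.+1) n t) * a 0 i ^+ 3
     + (6 * m2 * a 0 i ^+ 2
     + (4 * avg (fun t : n.-tuple Z => S (fun r => a r.+1) n t ^+ 3) * a 0 i + m4))))).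
    apply: eq_avg => i; rewrite -[in RHS](avg_cst nt (a 0 i ^+ 4)).
    rewrite [4 * avg _ * a 0 i]mulrAC [4 * avg _ * _]mulrAC [6 * _ * _]mulrAC.
    rewrite -!avgZ -!avgD; apply: eq_avg => t.
    by rewrite S_cons /S; ring.
  by rewrite !avgD !avgZ a1 a3 !mulr0 !add0r avg_cst.
have A20 : 0 <= A2.
  by rewrite -(avg_cst z0 0); apply: ler_avg => i; rewrite sqr_ge0.
have : 0 <= A2 ^+ 2 by rewrite sqr_ge0.
rewrite sqrrD; lra.
Qed.

End Moments.

(* [x * (x - 2 s)^2 * (x + 4 s) >= 0] *)
Lemma ler_abs_moments (R : realFieldType) (s x : R) : 0 < s ->
  3 / (4 * s) * x ^+ 2 - x ^+ 4 / (16 * s ^+ 3) <= `|x|.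
Proof.
move=> s0; rewrite -subr_ge0.
have -> : `|x| - (3 / (4 * s) * x ^+ 2 - x ^+ 4 / (16 * s ^+ 3)) =
   `|x| * (`|x| - 2 * s) ^+ 2 * (`|x| + 4 * s) / (16 * s ^+ 3).
  rewrite -(real_normK (num_real x)) (exprM x 2 2 : x ^+ 4 = _).
  rewrite -(real_normK (num_real x)); field.
  by rewrite gt_eqF.
have s0' := ltW s0.
by apply: mulr_ge0; rewrite ?invr_ge0;
  repeat (first [exact: sqr_ge0 | apply: mulr_ge0 | apply: addr_ge0 | apply: exprn_ge0]);
  rewrite ?normr_ge0 ?ler0n.
Qed.

(** * Signs, and maps of sequences acting on tuples *)

Definition bsign (R : pzRingType) (b : bool) : R := if b then 1 else -1.
Arguments bsign {R} b.

Lemma bsign_addb (R : realFieldType) (a b : bool) :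
  ((a (+) b)%:R : R) = (1 - bsign a * bsign b) / 2.
Proof. by case: a; case: b => /=; rewrite /bsign; lra. Qed.

Lemma bsignN (R : pzRingType) b : bsign (~~ b) = - bsign b :> R.
Proof. by case: b => //=; rewrite /bsign opprK. Qed.

Definition mkseq_tuple (A : Type) (f : nat -> A) n : n.-tuple A :=
  map_tuple f (iota_tuple n 0).

Lemma nth_mkseq_tuple (A : Type) (a0 : A) (f : nat -> A) n t :
  (t < n)%N -> nth a0 (mkseq_tuple f n) t = f t.
Proof. exact: nth_mkseq. Qed.

Section FunctionsAsTuples.
Context {A : finType} (a0 : A) (n : nat).

(** Lets changes of variables be written on functions of all times: if entries below [n] depend only
    on entries below [n], an involution restricts to tuples. *)
Lemma mkseq_tupleK (F : (nat -> A) -> (nat -> A)) :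
  (forall f t, F (F f) t = f t) ->
  (forall f g t, (t < n)%N -> (forall r, (r < n)%N -> f r = g r) ->
     F f t = F g t) ->
  involutive (fun s : n.-tuple A => mkseq_tuple (F (nth a0 s)) n : n.-tuple A).
Proof.
move=> FK eqF s; apply/val_inj/(@eq_from_nth _ a0); first by rewrite !size_tuple.
move=> t; rewrite size_tuple => tn; rewrite nth_mkseq_tuple//.
rewrite -[RHS]FK; apply: eqF => // r rn; by rewrite nth_mkseq_tuple.
Qed.

End FunctionsAsTuples.

(** * Coupling of the labels with the directions *)

Section Coupling.
Context (R : realType) (d N L T : nat).
Notation V := {ffun 'I_d.+1 -> bool}.
Notation Om := ('I_d.+1 * V)%type.
Notation M := T.+1.
Notation noise_time_ := (noise_time L).
Notation stage_ := (stage L).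
Notation playing_ := (playing N L).
Let om0 : Om := (ord0, [ffun=> false]).
Hypothesis NLT : (N * L.+1 <= M)%N.

Implicit Types (o : nat -> Om) (w y : nat -> bool).

(** The last noise time may equal [T], just after the final round [T - 1]; this is why [M = T.+1]
    outcomes are drawn. *)
Lemma noise_time_le k : (k < N)%N -> (noise_time_ k <= T)%N.
Proof.
move=> kN; rewrite -ltnS; apply: leq_trans NLT.
by rewrite /noise_time -addnS -mulSnr leq_mul2r kN orbT.
Qed.

Lemma noise_time_ltM t : playing_ t -> (noise_time_ (stage_ t) < M)%N.
Proof. by case/andP => _ /noise_time_le; rewrite ltnS. Qed.

Definition cell_round o k j r : bool :=
  [&& playing_ r, stage_ r == k & (o r).1 == j].

Definition cell_sum n o w k j : R :=
  \sum_(r < n | cell_round o k j r) bsign (w r).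

Definition majority o w t j : bool := 0 <= cell_sum t o w (stage_ t) j.

(* Flips the bits revealed at a noise time by the majority votes of the stage
   that ends there; as the votes only involve the first components of [o], this
   is an involution, hence preserves the uniform law of the outcomes. *)
Definition twist w o t : Om :=
  ((o t).1, [ffun j => (o t).2 j (+) majority o w t j]).

(** The label given to the instance of round [t] by the hypothesis of the branch followed, known
    only when the stage ends. *)
Definition target o t : bool :=
  playing_ t && (o (noise_time_ (stage_ t))).2 (o t).1.

Lemma eq_cell_sum n o o' w w' k j :
  (forall r, (r < n)%N -> (o r).1 = (o' r).1) ->
  (forall r, (r < n)%N -> w r = w' r) ->
  cell_sum n o w k j = cell_sum n o' w' k j.
Proof.
move=> oo' ww'; apply: eq_big => r; first by rewrite /cell_round oo'.
by move=> _; rewrite ww'.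
Qed.

Lemma eq_twist o o' w w' t : (forall r, (r <= t)%N -> o r = o' r) ->
  (forall r, (r < t)%N -> w r = w' r) -> twist w o t = twist w' o' t.
Proof.
move=> oo' ww'; rewrite /twist oo'//; congr pair; apply/ffunP => j.
rewrite !ffunE /majority (@eq_cell_sum _ o o' w w')// => r rt.
by rewrite oo'// ltnW.
Qed.

Lemma twistK w o t : twist w (twist w o) t = o t.
Proof.
rewrite /twist/= [RHS]surjective_pairing; congr pair; apply/ffunP => j.
rewrite !ffunE /majority (@eq_cell_sum t (twist w o) o w w)//.
by rewrite -addbA addbb addbF.
Qed.

Lemma eq_target o o' t : (t < M)%N -> (forall r, (r < M)%N -> o r = o' r) ->
  target o t = target o' t.
Proof.
move=> tM oo'; rewrite /target; have [pt|//] := boolP (playing_ t).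
by rewrite (oo' _ tM) (oo' _ (noise_time_ltM pt)).
Qed.

Lemma target_twist w o t : target (twist w o) t =
  target o t (+) (playing_ t && majority o w (noise_time_ (stage_ t)) (o t).1).
Proof. by rewrite /target /twist/= ffunE; case: (playing_ t). Qed.

(** The cell is complete at its noise time, so the majority bit is the sign of the whole sum; in a
    tie both sides are 0. *)
Lemma bsign_majority o w k j : (k < N)%N ->
  bsign (majority o w (noise_time_ k) j) * cell_sum T o w k j =
  `|cell_sum T o w k j|.
Proof.
move=> kN.
have -> : cell_sum T o w k j = cell_sum (noise_time_ k) o w k j.
  rewrite /cell_sum [RHS](big_ord_widen_cond T (cell_round o k j)
    (fun r => bsign (w r)))//; last exact: noise_time_le.
  apply: eq_bigl => r; have [/and3P[pr /eqP sr _]|//] := boolP (cell_round _ _ _ _).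
  by rewrite -sr (playing_lt_noise_time pr).
rewrite /majority stage_noise_time; case: ler0P => h; rewrite /bsign.
  case: ifP => h'; last by rewrite mulN1r.
  by have /eqP -> : cell_sum (noise_time_ k) o w k j == 0;
    rewrite ?eq_le ?h ?h' ?mulr0 ?oppr0.
by rewrite ltW// mul1r.
Qed.

Lemma sum_playing_cells o w :
  \sum_(t < T | playing_ t)
     bsign (w t) * bsign (majority o w (noise_time_ (stage_ t)) (o t).1) =
  \sum_(k < N) \sum_j `|cell_sum T o w k j|.
Proof.
have [->|N0] := posnP N.
  by rewrite big_ord0 big1// => t /andP[].
(* Leftover rounds fall back on stage 0, but the sum ranges over playing rounds only. *)
pose st (t : 'I_T) : 'I_N := insubd (Ordinal N0) (stage_ t).
have stE (t : 'I_T) : playing_ t -> st t = stage_ t :> nat.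
  by move=> /andP[_ tN]; rewrite val_insubd tN.
rewrite (partition_big st xpredT)//=; apply: eq_bigr => k _.
rewrite (partition_big (fun t : 'I_T => (o t).1) xpredT)//=.
apply: eq_bigr => j _; rewrite -bsign_majority// /cell_sum mulr_sumr.
apply: eq_big => [t|t].
  rewrite /cell_round; have [pt|//] := boolP (playing_ t).
  by rewrite /= -val_eqE/= stE.
by move=> /andP[/andP[pt /eqP <-] /eqP <-]; rewrite stE// mulrC.
Qed.

(* With mu = L / d.+1 >= 1, the second moment of the sum is mu and the fourth
   is at most 3 mu^2 + mu <= 4 mu^2. *)
Lemma avg_cell_sum k j : (k < N)%N -> (d < L)%N ->
  Num.sqrt (L%:R / d.+1%:R) / 2 <=
  avg (fun s : M.-tuple Om => avg (fun w : M.-tuple bool =>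
    `|cell_sum T (nth om0 s) (nth false w) k j|)).
Proof.
move=> kN dL.
rewrite (@avg_zip _ _ _ _ (fun (s : seq Om) (w : seq bool) =>
  `|cell_sum T (nth om0 s) (nth false w) k j|)).
pose act r := [&& (r < T)%N, playing_ r & stage_ r == k].
(* The contribution of round [r] as a function of its own outcome and coin: 1 or -1 with probability
   [1 / (2 * d.+1)] each in an active round, otherwise 0. *)
pose a r (x : Om * bool) : R :=
  if act r && (x.1.1 == j) then bsign x.2 else 0.
pose S (t : seq (Om * bool)) := \sum_(r < M) a r (nth (om0, false) t r).
have SE (t : M.-tuple (Om * bool)) :
    cell_sum T (nth om0 (unzip1 t)) (nth false (unzip2 t)) k j = S t.
  rewrite /S big_ord_recr/= {2}/a /act ltnn/= addr0 /cell_sum big_mkcond/=.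
  apply: eq_bigr => r _; rewrite /a /act ltn_ord /cell_round/=.
  have rM : (r < size t)%N by rewrite size_tuple ltnS ltnW.
  by rewrite (nth_map (om0, false))// (nth_map (om0, false))// -!andbA.
under eq_avg do rewrite SE.
have avg_a (f : R -> R) r : f 0 = 0 ->
    avg (fun x => f (a r x)) = if act r then (f 1 + f (- 1)) / 2 / d.+1%:R else 0.
  move=> f0; case actr: (act r); last first.
    by rewrite -[RHS](avg_cst (om0, false)); apply: eq_avg => x; rewrite /a actr.
  rewrite avg_pair avg_pair.
  transitivity (avg (fun i : 'I_d.+1 => if i == j then (f 1 + f (- 1)) / 2 else 0)).
    apply: eq_avg => i; rewrite -[RHS](avg_cst ([ffun=> false] : V)).
    apply: eq_avg => v; rewrite /avg card_bool big_bool /a actr/= /bsign.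
    by case: eqP => // _; rewrite f0; lra.
  by rewrite /avg card_ord -big_mkcond big_pred1_eq.
have cnt : \sum_(r < M) (if act r then 1 else 0) = L%:R :> R.
  rewrite (eq_bigr (fun r : 'I_M => (act r)%:R)); last first.
    by move=> r _; case: (act r).
  rewrite -natr_sum -(big_mkord xpredT (fun r => act r : nat)).
  pose lo := (k * L.+1)%N.
  have loT : (lo + L <= T)%N by exact: noise_time_le.
  have actE r : act r = (lo <= r)%N && (r < lo + L)%N.
    apply/idP/idP => [/and3P[_ /andP[rL _] /eqP rk]|/andP[lor rhi]].
      by rewrite /lo -rk {2 3}(divn_eq r L.+1) /stage leq_addr ltn_add2l.
    rewrite /act (leq_trans rhi)//= /playing.
    have -> : r = (k * L.+1 + (r - lo))%N by rewrite subnKC.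
    have rL : (r - lo < L)%N by rewrite ltn_subLR.
    have rL' : (r - lo < L.+1)%N by rewrite ltnW.
    by rewrite /stage modnMDl divnMDl// divn_small// modn_small// addn0 rL kN eqxx.
  rewrite (eq_bigr (fun r => if (lo <= r)%N && (r < lo + L)%N then 1%N else 0%N)); last first.
    by move=> r _; rewrite actE; case: ifP.
  rewrite -big_mkcond/= -(big_nat_widen 0 (lo + L) M (fun r => lo <= r)%N); last by rewrite ltnW.
  have := @big_nat_widenl _ 0%N addn lo 0 (lo + L) xpredT (fun=> 1%N) (leq0n _).
  by rewrite /= sum_nat_const_nat muln1 addKn => <-.
pose mu : R := L%:R / d.+1%:R.
have sum_act (c : R) : \sum_(r < M) (if act r then c / d.+1%:R else 0) = c * mu.
  rewrite /mu -cnt mulr_suml mulr_sumr; apply: eq_bigr => r _.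
  by case: ifP; rewrite ?mul0r ?mulr0// mul1r.
have a1 r : avg (a r) = 0.
  by rewrite (avg_a id)//; case: ifP => // _; rewrite subrr !mul0r.
have a3 r : avg (fun x => a r x ^+ 3) = 0.
  rewrite (avg_a (fun x => x ^+ 3)) ?expr0n//; case: ifP => // _.
  by rewrite expr1n exprS sqrrN expr1n mulr1 subrr !mul0r.
have m2 : \sum_(r < M) avg (fun x => a r x ^+ 2) = mu.
  rewrite -[RHS]mul1r -sum_act; apply: eq_bigr => r _.
  rewrite (avg_a (fun x => x ^+ 2)) ?expr0n//; case: ifP => // _.
  by rewrite sqrrN !expr1n; congr (_ / _); lra.
have m4 : \sum_(r < M) avg (fun x => a r x ^+ 4) = mu.
  rewrite -[RHS]mul1r -sum_act; apply: eq_bigr => r _.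
  rewrite (avg_a (fun x => x ^+ 4)) ?expr0n//; case: ifP => // _.
  by rewrite -[4%N]/(2 * 2)%N !exprM sqrrN !expr1n; congr (_ / _); lra.
have S2 := @sum_moment2 R _ (om0, false) a M a1; rewrite m2 in S2.
have S4 := @sum_moment4 R _ (om0, false) a M a1 a3; rewrite m2 m4 in S4.
have mu1 : 1 <= mu by rewrite ler_pdivlMr ?ltr0n// mul1r ler_nat.
set sg := Num.sqrt _.
have sg0 : 0 < sg by rewrite sqrtr_gt0 (lt_le_trans _ mu1).
have sg2 : sg ^+ 2 = mu by rewrite sqr_sqrtr// (le_trans _ mu1).
(* The choice [s = sg] gives at least [3/4 * sg - 4 * sg^4 / (16 * sg^3) = sg / 2]. *)
apply: le_trans _ (ler_avg (fun t : M.-tuple (Om * bool) => ler_abs_moments (S t) sg0)).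
rewrite avgB avgZ S2.
under [X in _ <= _ - X]eq_avg => t do rewrite mulrC.
rewrite avgZ -sg2.
move: S4; rewrite -sg2.
set E4 := avg _ => S4.
have E4sg : E4 / (16 * sg ^+ 3) <= sg / 4.
  rewrite ler_pdivrMr ?mulr_gt0 ?exprn_gt0// (le_trans S4)//.
  have : sg ^+ 2 <= sg ^+ 2 ^+ 2 by rewrite ler_eXnr// sg2.
  by move=> h; rewrite (_ : sg / 4 * _ = 4 * sg ^+ 2 ^+ 2); [lra|field].
rewrite mulrC in E4sg.
rewrite (_ : 3 / (4 * sg) * sg ^+ 2 = 3 / 4 * sg); last by field; rewrite gt_eqF.
rewrite -/(S _) in E4sg *; lra.
Qed.

Definition flip t w r : bool := w r (+) (r == t).

Lemma reindex_flip t (F : (nat -> bool) -> R) :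
  (forall w w', (forall r, (r < M)%N -> w r = w' r) -> F w = F w') ->
  avg (fun w : M.-tuple bool => F (nth false w)) =
  avg (fun w : M.-tuple bool => F (flip t (nth false w))).
Proof.
move=> eqF; rewrite (reindex_avg (h := fun w : M.-tuple bool =>
  mkseq_tuple (flip t (nth false w)) M)).
  by apply: eq_avg => w; apply: eqF => r rM; rewrite nth_mkseq_tuple.
apply: mkseq_tupleK => [f r|f g r rM fg]; first by rewrite /flip addbK.
by rewrite /flip fg.
Qed.

Lemma avg_bsign t : (t < M)%N ->
  avg (fun w : M.-tuple bool => bsign (nth false w t)) = 0 :> R.
Proof.
move=> tM; suff : avg (fun w : M.-tuple bool => bsign (nth false w t)) =
    - avg (fun w : M.-tuple bool => bsign (nth false w t)) :> R by lra.
rewrite [LHS](reindex_flip t (F := fun w => bsign (w t))); last by move=> w w' ->.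
rewrite -mulN1r -avgZ; apply: eq_avg => w.
by rewrite /flip eqxx addbT bsignN mulN1r.
Qed.

(** * Expected regret under the coupling *)

Section Regret.
Context dX (X : measurableType dX).
Variables (pt : seq V -> 'I_d.+1 -> X) (z : V -> X).
Variable phi : seq X -> seq bool -> R.
Notation trajectory_ := (trajectory pt z N L).

(** The subtracted sum is the loss of the hypothesis of the branch drawn by [o], which labels noise
    points 0. *)
Definition regret_gap o y : R :=
  learner_loss phi T (trajectory_ o T) (mkseq y T) -
  \sum_(t < T) (y t (+) target o t)%:R.

Lemma eq_learner_loss o o' y y' : (forall t, (t < T)%N -> o t = o' t) ->
  (forall t, (t < T)%N -> y t = y' t) ->
  learner_loss phi T (trajectory_ o T) (mkseq y T) =
  learner_loss phi T (trajectory_ o' T) (mkseq y' T).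
Proof.
move=> oo' yy'; rewrite (@eq_trajectory _ _ _ pt z N L o o')//.
congr learner_loss; apply/eq_in_map => t; rewrite mem_iota => /andP[_ tT].
exact: yy'.
Qed.

Lemma eq_regret_gap o o' y y' : (forall t, (t < M)%N -> o t = o' t) ->
  (forall t, (t < M)%N -> y t = y' t) -> regret_gap o y = regret_gap o' y'.
Proof.
move=> oo' yy'; congr (_ - _).
  by apply: eq_learner_loss => t tT; [apply: oo'|apply: yy']; rewrite ltnW.
apply: eq_bigr => t _; have tM : (t < M)%N by rewrite ltnW// ltnS.
by rewrite yy'// (eq_target tM oo').
Qed.

Lemma take_trajectory o n m : (m <= n)%N ->
  take m (trajectory_ o n) = trajectory_ o m.
Proof. by move=> mn; rewrite /trajectory -map_take take_iota (minn_idPl mn). Qed.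

(* Given the past, the label of a round is a fair coin: neither the instances
   up to round [t] nor the labels before [t] depend on the label of round [t]. *)
Lemma avg_learner_loss o :
  T%:R / 2 <= avg (fun y : M.-tuple bool =>
    learner_loss phi T
      (trajectory_ (twist (fun t => nth false y t (+) target o t) o) T)
      (mkseq (nth false y) T)).
Proof.
have y0 : M.-tuple bool := nseq_tuple M false.
rewrite /learner_loss avg_sum -[T in T%:R]card_ord -sum1_card natr_sum mulr_suml.
apply: ler_sum => t _; have tM : (t < M)%N by rewrite ltnW// ltnS.
pose x y := trajectory_ (twist (fun t => y t (+) target o t) o) t.+1.
pose F y := abs_loss (phi (x y) (mkseq y t)) (y t).
have eqx (y y' : nat -> bool) : (forall r, (r < t)%N -> y r = y' r) -> x y = x y'.
  move=> yy'; apply: eq_trajectory => r rt; apply: eq_twist => // i ir.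
  by rewrite yy'// (leq_trans ir).
have eqm (y y' : nat -> bool) : (forall r, (r < t)%N -> y r = y' r) ->
    mkseq y t = mkseq y' t.
  by move=> yy'; apply/eq_in_map => r; rewrite mem_iota => /andP[_ /yy'].
rewrite (eq_avg (G := fun y : M.-tuple bool => F (nth false y))); last first.
  move=> y; rewrite take_trajectory// nth_mkseq// /F; congr abs_loss; congr phi.
  by rewrite /mkseq -map_take take_iota (minn_idPl _)// ltnW.
have Fflip : avg (fun y : M.-tuple bool => F (nth false y)) =
    avg (fun y : M.-tuple bool => F (flip t (nth false y))).
  apply: (reindex_flip t) => y y' yy'.
  have yy t' : (t' < t)%N -> y t' = y' t' by move=> ?; apply: yy'; rewrite (ltn_trans _ tM).
  by rewrite /F (eqx _ _ yy) (eqm _ _ yy) yy'.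
(* Flipping the label of round [t] keeps the prediction [p], and [|p - 0| + |p - 1| >= 1]. *)
suff : 1 <= avg (fun y : M.-tuple bool => F (nth false y)) +
     avg (fun y : M.-tuple bool => F (flip t (nth false y))).
  by rewrite -Fflip; lra.
rewrite -avgD -(avg_cst y0 1); apply: ler_avg => y.
have ff r : (r < t)%N -> flip t (nth false y) r = nth false y r.
  by move=> rt; rewrite /flip ltn_eqF// addbF.
rewrite /F (eqx _ _ ff) (eqm _ _ ff) /flip eqxx addbT /abs_loss.
set p := phi _ _; case: (nth false y t) => /=.
  by have := ler_distD p 1 0; rewrite subr0 normr1 distrC.
by have := ler_distD p 0 1; rewrite !sub0r !normrN normr1 subr0.
Qed.

(** Substituting [twist w o] for [o] turns the labels into [w (+) target o], and the branch then
    errs in a playing round exactly when [w t] differs from the majority of its cell. Its mean loss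
    is [T / 2] minus half the mean absolute cell sums. *)
Lemma avg_regret_gap : (d < L)%N ->
  N%:R * d.+1%:R * Num.sqrt (L%:R / d.+1%:R) / 4 <=
  avg (fun w : M.-tuple bool => avg (fun s : M.-tuple Om =>
    regret_gap (nth om0 s) (fun t => nth false w t (+)
      target (twist (nth false w) (nth om0 s)) t))).
Proof.
move=> dL; have s0 : M.-tuple Om := nseq_tuple M om0.
have w0 : M.-tuple bool := nseq_tuple M false.
pose wf (w : M.-tuple bool) := nth false w.
pose of_ (s : M.-tuple Om) := nth om0 s.
pose m w o t := playing_ t && majority o w (noise_time_ (stage_ t)) (o t).1.
pose learn w o := learner_loss phi T (trajectory_ (twist w o) T)
  (mkseq (fun t => w t (+) target o t) T).
rewrite (eq_avg (G := fun w : M.-tuple bool => avg (fun s : M.-tuple Om =>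
    learn (wf w) (of_ s) -
    \sum_(t < T) (1 - bsign (wf w t) * bsign (m (wf w) (of_ s) t)) / 2))); last first.
  move=> w; rewrite (reindex_avg (h := fun s : M.-tuple Om =>
    mkseq_tuple (twist (wf w) (of_ s)) M)).
    apply: eq_avg => s.
    transitivity (regret_gap (twist (wf w) (of_ s)) (fun t => wf w t (+) target (of_ s) t)).
      apply: eq_regret_gap => t tM; first by rewrite nth_mkseq_tuple.
      congr (_ (+) _); apply: eq_target => // r rM.
      rewrite -[RHS](twistK (wf w)); apply: eq_twist => // i ir.
      by rewrite nth_mkseq_tuple// (leq_ltn_trans ir).
    congr (_ - _); apply: eq_bigr => t _.
    by rewrite target_twist -/(m _ _ _) addbA addbK bsign_addb.
  apply: mkseq_tupleK => [f t|f g t tM fg]; first exact: twistK.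
  by apply: eq_twist => // r rt; apply: fg; rewrite (leq_ltn_trans rt).
rewrite (eq_avg (fun w : M.-tuple bool => avgB _ _)) avgB.
have learn_ge : T%:R / 2 <=
    avg (fun w : M.-tuple bool => avg (fun s : M.-tuple Om => learn (wf w) (of_ s))).
  (* For fixed outcomes, adding [target] to [w] is an involution, so the labels are again
     uniform. *)
  rewrite exchange_avg -(avg_cst s0 (T%:R / 2)); apply: ler_avg => s.
  apply: le_trans (avg_learner_loss (of_ s)) _.
  rewrite [leRHS](reindex_avg (h := fun w : M.-tuple bool =>
    mkseq_tuple (fun t => wf w t (+) target (of_ s) t) M)).
    rewrite le_eqVlt; apply/orP; left; apply/eqP/eq_avg => y.
    apply: eq_learner_loss => t tT.
      apply: eq_twist => // r rt; rewrite /wf nth_mkseq_tuple//.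
      by rewrite (ltn_trans rt)// (ltn_trans tT).
    by rewrite /wf nth_mkseq_tuple ?addbK// ltnW.
  apply: (@mkseq_tupleK bool false M (fun w t => w t (+) target (of_ s) t)) =>
    [f t|f g t tM ->//].
  by rewrite addbK.
suff : avg (fun w : M.-tuple bool => avg (fun s : M.-tuple Om =>
    \sum_(t < T) (1 - bsign (wf w t) * bsign (m (wf w) (of_ s) t)) / 2)) <=
    T%:R / 2 - N%:R * d.+1%:R * Num.sqrt (L%:R / d.+1%:R) / 4 :> R.
  by move=> hyp; apply: le_trans _ (lerB learn_ge hyp); lra.
have splitE (w : M.-tuple bool) (s : M.-tuple Om) :
    \sum_(t < T) (1 - bsign (wf w t) * bsign (m (wf w) (of_ s) t)) / 2 =
   T%:R / 2 + (- 2^-1 * \sum_(k < N) \sum_j `|cell_sum T (of_ s) (wf w) k j|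
     + 2^-1 * \sum_(t < T | ~~ playing_ t) bsign (wf w t)).
  rewrite -sum_playing_cells -mulr_suml sumrB sumr_const card_ord.
  rewrite (bigID (fun t : 'I_T => playing_ t))/=.
  rewrite (eq_bigr (fun t : 'I_T => bsign (wf w t) *
    bsign (majority (of_ s) (wf w) (noise_time_ (stage_ t)) (of_ s t).1))); last first.
    by move=> t pt'; rewrite /m pt'.
  rewrite [X in _ - (_ + X)](eq_bigr (fun t : 'I_T => - bsign (wf w t))); last first.
    by move=> t pt'; rewrite /m (negbTE pt') /bsign/= mulrN1.
  by rewrite sumrN; lra.
rewrite (eq_avg (fun w : M.-tuple bool => eq_avg (splitE w))).
rewrite (eq_avg (fun w : M.-tuple bool => avgD _ _)) avgD.
rewrite (eq_avg (fun w : M.-tuple bool => avg_cst s0 _)).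
rewrite (avg_cst w0) lerD2l (eq_avg (fun w : M.-tuple bool => avgD _ _)) avgD.
rewrite (eq_avg (fun w : M.-tuple bool => avgZ _ _)) avgZ.
rewrite (eq_avg (fun w : M.-tuple bool => avg_cst s0 _)) avgZ.
(* Noise rounds cost the branch 1/2 on average, as they cost a guess. *)
rewrite [X in _ + _ * X](_ : _ = 0) ?mulr0 ?addr0; last first.
  by rewrite avg_sum big1// => t _; rewrite avg_bsign// ltnW// ltnS.
rewrite mulNr lerN2 exchange_avg (eq_avg (fun s : M.-tuple Om => avg_sum _ _)) avg_sum.
have cells : \sum_(k < N) \sum_(j < d.+1) Num.sqrt (L%:R / d.+1%:R) / 2 <=
    \sum_(k < N) avg (fun s : M.-tuple Om => avg (fun w : M.-tuple bool =>
       \sum_j `|cell_sum T (of_ s) (wf w) k j|)).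
  apply: ler_sum => k _; rewrite (eq_avg (fun s : M.-tuple Om => avg_sum _ _)) avg_sum.
  by apply: ler_sum => j _; exact: avg_cell_sum.
move: cells; rewrite !sumr_const !card_ord -mulrnA -[_ *+ _]mulr_natr natrM.
by rewrite mulrC => cells; lra.
Qed.

End Regret.
End Coupling.

(** * From the expected gap to the minimax regret *)

Lemma seq_regret_ge (R : realType) (X : Type) (H : set (X -> R))
    (phi : seq X -> seq bool -> R) T xs ys (h : X -> R) : H h -> size ys = T ->
  ((learner_loss phi T xs ys - hyp_loss h xs ys)%:E <= seq_regret H phi T xs)%E.
Proof.
move=> Hh sys; apply: le_ereal_sup_tmp.
exists ((learner_loss phi T xs ys)%:E -
  ereal_inf [set (hyp_loss h xs ys)%:E | h in H])%E; first by exists ys.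
by rewrite EFinB leeB// ereal_inf_lbound//; exists h.
Qed.

Lemma minimax_regret_ge dX (X : measurableType dX) (R : realType)
    (H : set (X -> R)) (P : set (process X R)) T (k : process X R) (b : \bar R) :
  P k -> (forall phi, (b <= pexp k T (seq_regret H phi T))%E) ->
  (b <= minimax_regret H P T)%E.
Proof.
move=> Pk bk; apply: le_ereal_inf_tmp => _ [phi _ <-].
by apply: le_ereal_sup_tmp; exists (pexp k T (seq_regret H phi T)) => //; exists k.
Qed.

Section LowerBound.
Context dX (X : measurableType dX) (R : realType) (d : nat).
Notation V := {ffun 'I_d.+1 -> bool}.
Notation Om := ('I_d.+1 * V)%type.
Let v0 : V := [ffun=> false].
Let om0 : Om := (ord0, v0).

(* A node is the list [p] of the directions leading to it and carries the
   points [pt p j]; a direction gives the label of each of these points. *)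
Definition realizes_tree (H : set (X -> R)) (pt : seq V -> 'I_d.+1 -> X)
    (z : V -> X) : Prop :=
  forall D : seq V, exists h, [/\ H h,
    (forall k j, (k < size D)%N -> h (pt (take k D) j) = (nth v0 D k j)%:R) &
    (forall v, h (z v) = 0)].

Variables (pt : seq V -> 'I_d.+1 -> X) (z : V -> X) (decode : X -> V).
Variables N L T : nat.
Hypothesis NLT : (N * L.+1 <= T.+1)%N.
Hypothesis dL : (d < L)%N.
Variable H : set (X -> R).
Hypothesis Htree : realizes_tree H pt z.
Hypothesis decode_meas : forall v, measurable (decode @^-1` [set v]).
Hypothesis zK : cancel z decode.
Hypothesis meas1 : forall x : X, measurable [set x].

(** The comparator realizes the branch [D] of the directions drawn at the [N] noise times. *)
Let regret_gap_le phi (o : nat -> Om) (y : nat -> bool) :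
  ((regret_gap N L T pt z phi o y)%:E <=
   seq_regret H phi T (trajectory pt z N L o T))%E.
Proof.
pose D := mkseq (fun k => (o (noise_time L k)).2) N.
have [h [Hh hpt hz]] := Htree D.
apply: le_trans (seq_regret_ge phi (trajectory pt z N L o T) Hh (size_mkseq y T)).
rewrite lee_fin /regret_gap lerD2l lerN2 le_eqVlt; apply/orP; left; apply/eqP.
rewrite /hyp_loss /trajectory /mkseq zip_map big_map.
rewrite -[in LHS](subn0 T) -/(index_iota 0 T) big_mkord.
apply: eq_bigr => t _ /=; rewrite /round_point /target; case: ifP => pt'.
  have kN : (stage L t < N)%N by case/andP: pt'.
  have -> : mkseq (fun k => (o (noise_time L k)).2) (stage L t) = take (stage L t) D.
    by rewrite /D /mkseq -map_take take_iota (minn_idPl (ltnW kN)).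
  rewrite hpt ?size_mkseq// nth_mkseq//= /abs_loss.
  set b := (o (noise_time L _)).2 _.
  by case: (y t); case: b => /=; rewrite ?subrr ?subr0 ?sub0r ?normrN ?normr0 ?normr1.
by rewrite hz /abs_loss sub0r normrN addbF; case: (y t); rewrite ?normr0 ?normr1.
Qed.

(** The labels depend on [w] and on all [T.+1] outcomes, the instances on the first [T] only.
    Averaging over [w] and the last outcome stays below the supremum over labels. *)
Lemma pexp_tree_process_ge phi :
  ((N%:R * d.+1%:R * Num.sqrt (L%:R / d.+1%:R) / 4)%:E <=
   pexp (tree_process R pt z N L decode_meas) T (seq_regret H phi T))%E.
Proof.
have w0 : T.+1.-tuple bool := nseq_tuple _ false.
pose G (w : T.+1.-tuple bool) (s : seq Om) : R :=
  regret_gap N L T pt z phi (nth om0 s)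
    (fun t => nth false w t (+) target N L (twist R N L (nth false w) (nth om0 s)) t).
have Gle (w : T.+1.-tuple bool) : ((avg (fun s : T.+1.-tuple Om => G w s))%:E <=
    pexp (tree_process R pt z N L decode_meas) T (seq_regret H phi T))%E.
  rewrite avg_tuple_rcons.
  apply: (@pexp_ge _ _ _ _ _ _ _ _ _ decode_meas zK meas1 _ _
    (fun t => avg (fun i => G w (rcons t i)))) => t.
  apply: (avg_le_ereal om0) => i.
  rewrite (_ : trajectory _ _ _ _ _ _ =
    trajectory pt z N L (nth om0 (rcons t i)) T); last first.
    by apply: eq_trajectory => r rT; rewrite nth_rcons size_tuple rT.
  exact: regret_gap_le.
apply: le_trans _ (avg_le_ereal w0 Gle).
by rewrite lee_fin; exact: avg_regret_gap.
Qed.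

End LowerBound.

(** * A class on [nat] of bounded VC dimension realizing the tree *)

Lemma InP (A : eqType) (x : A) (s : seq A) : reflect (List.In x s) (x \in s).
Proof.
elim: s => [|a s IH] /=; first by constructor.
rewrite inE; apply: (iffP orP) => -[].
- by move=> /eqP ->; left.
- by move=> /IH; right.
- by move=> ->; left.
- by move=> /IH; right.
Qed.

Lemma NoDup_uniq (A : eqType) (s : seq A) : List.NoDup s -> uniq s.
Proof.
by elim=> //= a l al _ ->; rewrite andbT; apply/negP => /InP.
Qed.

Section PathClass.
Context (R : realType) (d : nat).
Notation V := {ffun 'I_d.+1 -> bool}.
Notation Node := ((seq V * 'I_d.+1) + V)%type.
Let v0 : V := [ffun=> false].

Definition node_of (x : nat) : option Node := pickle_inv x.

(** Label 1 means that node [p] lies on the branch [D] and that the next direction has bit [j]; at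
    the end of [D] the default [v0] gives 0. *)
Definition path_hyp (D : seq V) (x : nat) : R :=
  if node_of x is Some (inl (p, j)) then (prefix p D && nth v0 D (size p) j)%:R
  else 0.

Definition path_class : set (nat -> R) := range path_hyp.
Definition path_point (p : seq V) (j : 'I_d.+1) : nat := pickle (inl (p, j) : Node).
Definition path_noise (v : V) : nat := pickle (inr v : Node).
Definition path_decode (x : nat) : V := if node_of x is Some (inr v) then v else v0.

Lemma path_noiseK : cancel path_noise path_decode.
Proof. by move=> v; rewrite /path_decode /node_of /path_noise pickleK_inv. Qed.

Lemma path_class_binary : binary_class path_class.
Proof.
move=> _ [D _ <-] x; rewrite /path_hyp.
case: node_of => [[[p j]|v]|]; [|by left|by left].
by case: (_ && _); [right|left].
Qed.

Lemma path_class_realizes : realizes_tree path_class path_point path_noise.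
Proof.
move=> D; exists (path_hyp D); split; first by exists D.
  move=> k j kD; rewrite /path_hyp /node_of /path_point pickleK_inv.
  by rewrite prefix_take size_take kD.
by move=> v; rewrite /path_hyp /node_of /path_noise pickleK_inv.
Qed.

Lemma prefix_nth (A : eqType) (x0 : A) (s t : seq A) i :
  prefix s t -> (i < size s)%N -> nth x0 t i = nth x0 s i.
Proof. by move=> /prefixP[u ->]; rewrite nth_cat => ->. Qed.

(* Two distinct points with the same index [j] on a common branch are not
   shattered: the label of the shallower one is determined by the deeper one. *)
Lemma path_class_VC : VC_le path_class d.+1.
Proof.
move=> S NDS shS.
pose lbl x : 'I_d.+1 := if node_of x is Some (inl (p, j)) then j else ord0.
(* The all-ones labelling puts every point of [S] on one branch [D0]. *)
have [_ [D0 _ <-] all1] := shS (fun=> true).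
have node x : x \in S -> exists p, [/\ x = path_point p (lbl x),
    prefix p D0 & nth v0 D0 (size p) (lbl x)].
  move=> /InP /all1; rewrite /path_hyp /lbl.
  case E: node_of => [[[p j]|v]|] /=; [|move/eqP; by rewrite eq_sym oner_eq0..].
  have := @pickle_invK Node x; rewrite /= -/(node_of x) E /= => xE.
  case: (boolP (_ && _)) => [/andP[pD Dj] _|_ /eqP]; last by rewrite eq_sym oner_eq0.
  by exists p; split.
have shallow x x' p p' : x \in S -> x' \in S -> lbl x = lbl x' ->
    x = path_point p (lbl x) -> x' = path_point p' (lbl x') ->
    prefix p D0 -> prefix p' D0 -> nth v0 D0 (size p) (lbl x) ->
    (size p <= size p')%N -> x = x'.
  move=> xS x'S lxx' xE x'E pD p'D Dj pp'.
  have pE : take (size p) D0 = p by apply/eqP; rewrite -prefixE.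
  have p'E : take (size p') D0 = p' by apply/eqP; rewrite -prefixE.
  have ppp' : prefix p p' by rewrite prefixE -p'E take_takel// pE.
  move: pp'; rewrite leq_eqVlt => /orP[/eqP pp'|pp'].
    have pp : p = p' by rewrite -pE -p'E pp'.
    by rewrite [LHS]xE [RHS]x'E lxx' pp.
  (* Label 1 at [x'] forces [D1] through [p'], so [D1] agrees with [D0] at depth [size p] and labels
     [x] by 1 as well. *)
  have [_ [D1 _ <-] D1E] := shS (fun u => u == x').
  have := D1E x' (elimT (InP _ _) x'S); rewrite eqxx.
  rewrite {1}/path_hyp /node_of {1}x'E /path_point pickleK_inv.
  case: (boolP (prefix p' D1)) => [p'D1 _|_ /eqP]; last by rewrite eqr_nat.
  apply/eqP; have := D1E x (elimT (InP _ _) xS).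
  rewrite {1}/path_hyp /node_of {1}xE /path_point pickleK_inv.
  rewrite (prefix_trans ppp' p'D1) (prefix_nth _ p'D1)// -(prefix_nth _ p'D)//.
  by rewrite Dj /=; case: eqP => // _ /eqP; rewrite eqr_nat.
have inj : {in S &, injective lbl}.
  move=> x x' xS x'S lxx'.
  have [p [xE pD Dj]] := node x xS; have [p' [x'E p'D D'j]] := node x' x'S.
  have [pp'|/ltnW pp'] := leqP (size p) (size p').
    exact: (shallow x x' p p' xS x'S lxx' xE x'E pD p'D Dj pp').
  apply/esym.
  exact: (shallow x' x p' p x'S xS (esym lxx') x'E xE p'D pD D'j pp').
rewrite -[length S]/(size S) -(size_map lbl) -[leqRHS]card_ord.
have /card_uniqP <- : uniq (map lbl S) by rewrite map_inj_in_uniq// NoDup_uniq.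
exact: max_card.
Qed.

End PathClass.

(** * Thresholds realize a binary tree *)

Section ThresholdTree.
Context (R : realType).
Notation V := {ffun 'I_1 -> bool}.

(** Midpoint of the interval reached by bisecting [0,1], where [true] selects the left half: a
    smaller threshold labels the old midpoint 1. *)
Fixpoint dyadic (p : seq bool) : R :=
  if p is b :: p' then (if b then dyadic p' / 2 else (1 + dyadic p') / 2)
  else 1 / 2.

Lemma dyadic_lt1 p : 0 < dyadic p < 1.
Proof.
elim: p => [|[] p /andP[p0 p1]] /=; apply/andP; split; lra.
Qed.

Lemma dyadic_take (p : seq bool) k : (k < size p)%N ->
  (dyadic p <= dyadic (take k p)) = nth false p k.
Proof.
elim: p k => [|b p IH] [|k]//=.
  move=> _; have /andP[p0 p1] := dyadic_lt1 p.
  by case: b; [apply/idP; lra|apply/negbTE; rewrite -ltNge; lra].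
rewrite ltnS => /IH <-; case: b; first by rewrite ler_pM2r.
by rewrite ler_pM2r ?lerD2l.
Qed.

Definition bits (p : seq V) : seq bool := map (fun v : V => v ord0) p.
(** The tree is squeezed into (1/2, 1), leaving 0 and 1/4 below all thresholds used, as noise points
    encoding one bit. *)
Definition threshold_point (p : seq V) (j : 'I_1) : R := (1 + dyadic (bits p)) / 2.
Definition threshold_noise (v : V) : R := if v ord0 then 1 / 4 else 0.
Definition threshold_decode (x : R) : V := [ffun=> x == 1 / 4].

Lemma threshold_noiseK : cancel threshold_noise threshold_decode.
Proof.
move=> v; apply/ffunP => i; rewrite ffunE (ord1 i) /threshold_noise.
by case: ifP => _; [rewrite eqxx|rewrite lt_eqF//; lra].
Qed.

Lemma threshold_decode_meas v : measurable (threshold_decode @^-1` [set v]).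
Proof.
have E x : threshold_decode x = v <-> (x == 1 / 4) = v ord0.
  split=> [<-|xv]; first by rewrite ffunE.
  by apply/ffunP => i; rewrite ffunE (ord1 i).
have m : measurable [set (1 / 4 : R)] by exact: measurable_set1.
have [v1|v1] := boolP (v ord0).
  rewrite (_ : _ @^-1` _ = [set 1 / 4])//.
  by apply/seteqP; split=> x /= => [/E|->]; [rewrite v1 => /eqP|apply/E; rewrite v1 eqxx].
rewrite (_ : _ @^-1` _ = ~` [set 1 / 4]); first exact: measurableC.
apply/seteqP; split=> x /= => [/E|xE]; first by rewrite (negbTE v1) => /eqP.
by apply/E; rewrite (negbTE v1); apply/eqP.
Qed.

Lemma thresholds_realize :
  realizes_tree (@thresholds R) threshold_point threshold_noise.
Proof.
move=> D; have /andP[D0 D1] := dyadic_lt1 (bits D).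
exists (fun x : R => ((1 + dyadic (bits D)) / 2 <= x)%R%:R); split.
- by exists ((1 + dyadic (bits D)) / 2) => //; apply/andP; split; lra.
- move=> k j kD; rewrite /threshold_point ler_pM2r// lerD2l /bits map_take.
  by rewrite dyadic_take ?size_map// (nth_map [ffun=> false])// (ord1 j).
- by move=> v; rewrite (_ : (_ <= _) = false)//; apply/negbTE;
    rewrite -ltNge /threshold_noise; case: ifP => _; lra.
Qed.

End ThresholdTree.

(** * Choice of the parameters and conclusion *)

Lemma ln2_ge (R : realType) : 1 / 2 <= ln (2 : R).
Proof.
have := @le_ln1Dx R (- (1 / 2)); rewrite (_ : 1 + _ = 2^-1); last by lra.
by rewrite lnV ?posrE// => h; have := h ltac:(lra); lra.
Qed.

Section StageCount.
Local Open Scope nat_scope.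
Variables K T : nat.
Hypotheses (K1 : 1 <= K) (KT : K <= T).

(* [stages + 1 <= K] unless [K = 1], in which case there is no noise round. *)
Definition stages := uphalf K.
(** The largest [L] with [stages * L.+1 <= T.+1], the final noise time being allowed to fall just
    after the game. *)
Definition plays := (T.+1 %/ stages).-1.

Let stages_gt0 : 0 < stages. Proof. rewrite /stages; lia. Qed.
Let stages_le : stages <= T.+1. Proof. rewrite /stages; lia. Qed.

Lemma stages_plays : stages * plays.+1 <= T.+1 < stages * plays.+2.
Proof.
rewrite /plays prednK ?divn_gt0// mulnC leq_divM/= mulnC; exact: ltn_ceil.
Qed.

Lemma stages_noise t : t < T -> ~~ playing stages plays t -> stages < K.
Proof.
move=> tT; have [KE|K2] : K = 1 \/ 1 < K by lia.
  have tT1 : t < T.+1 by rewrite ltnW.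
  by rewrite /plays /playing /stage /stages KE/= divn1/= modn_small// divn_small// tT.
by move=> _; rewrite /stages; lia.
Qed.

End StageCount.

(** The square of the right-hand side is [d.+1 * n^2 * l / 16]. *)
Lemma sqrt_bound (R : realType) (c n l d k t : nat) (q : R) : 0 <= q ->
  (k * t <= c * n ^ 2 * l)%N -> 16 * c%:R * q <= 1 ->
  Num.sqrt ((k * d.+1 * t)%:R * q) <=
    n%:R * d.+1%:R * Num.sqrt (l%:R / d.+1%:R) / 4 :> R.
Proof.
move=> q0 h q1.
have s0 : 0 <= n%:R * d.+1%:R * Num.sqrt (l%:R / d.+1%:R) / 4 :> R.
  by rewrite !mulr_ge0// sqrtr_ge0.
rewrite -[leRHS]ger0_norm// -sqrtr_sqr ler_wsqrtr//.
rewrite !exprMn sqr_sqrtr; last by rewrite divr_ge0.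
have -> : n%:R ^+ 2 * d.+1%:R ^+ 2 * (l%:R / d.+1%:R) * 4^-1 ^+ 2 =
    d.+1%:R * (n%:R ^+ 2 * l%:R) / 16 :> R.
  have : d.+1%:R != 0 :> R by rewrite pnatr_eq0.
  by move: (d.+1%:R : R) => D D0; field.
have : (k * t)%:R <= (c * n ^ 2 * l)%:R :> R by rewrite ler_nat.
rewrite !natrM => {}h.
have := ler_wpM2l (mulr_ge0 (ler0n R d.+1) q0) h.
have nl0 : 0 <= d.+1%:R * (n%:R ^+ 2 * l%:R) :> R by rewrite !mulr_ge0// sqr_ge0.
have := ler_wpM2l nl0 q1; lra.
Qed.

Theorem theorem8 (R : realType) :
  (forall d K T : nat, (1 <= d)%N -> (1 <= K)%N ->
     8 * K%:R * d%:R * ln ((2 * K * d)%:R) <= (T%:R : R) ->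
     exists (dX : measure_display) (X : measurableType dX) (H : set (X -> R)),
       [/\ binary_class H, VC_le H d &
           ((Num.sqrt ((K * d * T)%:R / 64))%:E
              <= minimax_regret H (U_K1 X R K T) T)%E])
  /\
  (exists c : R, 0 < c /\
     forall K T : nat, (1 <= K)%N -> (K <= T)%N ->
       ((c * Num.sqrt ((K * T)%:R))%:E
          <= minimax_regret (@thresholds R) (U_K1 R R K T `&` on_unit R) T)%E).
Proof.
split.
  move=> [//|d] K T _ K1 hT.
  (* The logarithm is at least [ln 2 >= 1/2]. *)
  have {hT} : (4 * (K * d.+1) <= T)%N.
    rewrite -(ler_nat R); apply: le_trans hT; rewrite !natrM.
    have h : 1 / 2 <= ln ((2 * K * d.+1)%:R : R).
      apply: le_trans (ln2_ge R) _; rewrite ler_ln ?posrE ?ltr0n ?ler_nat//; nia.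
    have kd : 0 <= 8 * K%:R * d.+1%:R :> R by rewrite !mulr_ge0.
    have := ler_wpM2l kd h; rewrite !natrM; lra.
  move=> hT; have KT : (K <= T)%N by nia.
  have /andP[NL NL'] := stages_plays K1 KT.
  have NK : (K <= 2 * stages K <= K.+1)%N by rewrite /stages; lia.
  (* Otherwise [T < K * (d + 3)], against [4 * K * (d + 1) <= T]. *)
  have dL : (d < plays K T)%N.
    rewrite ltnNge; apply/negP => Ld.
    have : (stages K * (plays K T).+2 <= K * d.+3)%N.
      by apply: leq_mul; lia.
    nia.
  exists _, nat, (@path_class R d); split.
  - exact: path_class_binary.
  - exact: path_class_VC.
  apply: (minimax_regret_ge (k := tree_process R (@path_point d) (@path_noise d)
     (stages K) (plays K T) (decode := @path_decode d) (fun=> I))).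
    apply: tree_process_U_K1; first by rewrite /stages; lia.
    exact: stages_noise.
  move=> phi; apply: le_trans (pexp_tree_process_ge NL dL (@path_class_realizes R d) _
     (@path_noiseK d) (fun=> I) phi).
  rewrite lee_fin; apply: (sqrt_bound (c := 4)); rewrite ?invr_ge0//; last lra.
  nia.
exists (1 / 16); split; first by lra.
move=> K T K1 KT.
have /andP[NL NL'] := stages_plays K1 KT.
have NK : (K <= 2 * stages K <= K.+1)%N by rewrite /stages; lia.
have L0 : (0 < plays K T)%N.
  rewrite lt0n; apply/eqP => L0; move: NL'; rewrite L0; lia.
apply: (minimax_regret_ge (k := tree_process R (@threshold_point R)
  (@threshold_noise R) (stages K) (plays K T) (@threshold_decode_meas R))).
  split.
    apply: tree_process_U_K1; first by rewrite /stages; lia.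
    exact: stages_noise.
  move=> h; rewrite kseq_tree_process; apply: unif_law_eq1 => o.
  rewrite /round_point; case: ifP => _ /=; rewrite in_itv/=.
    rewrite /threshold_point; set p := bits _; have := dyadic_lt1 R p; lra.
  by rewrite /threshold_noise; case: ifP => _; apply/andP; split; lra.
move=> phi; apply: le_trans (pexp_tree_process_ge NL L0 (@thresholds_realize R) _
  (@threshold_noiseK R) (fun x => measurable_set1 x) phi).
rewrite lee_fin.
(* As [plays >= 1], one has [T <= 3 * stages * plays] and [K <= 2 * stages], so a factor 6 would do;
   16 makes [1 / 256] a square. *)
apply: le_trans (@sqrt_bound R 16 (stages K) (plays K T) 0 K T (1 / 256) _ _ _); last 3 first.
- by lra.
nia.
- by lra.
rewrite muln1 sqrtrM// mulrC ler_wpM2l ?sqrtr_ge0//.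
rewrite (_ : 1 / 256 = (1 / 16) ^+ 2); last by rewrite expr2; lra.
by rewrite sqrtr_sqr ger0_norm//; lra.
Qed.
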